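(* Let $\alpha(x)$ and $\beta(x)$ be continuous functions and let $n$ be any real number with $n\neq0$ and $n\neq1$. Consider the substitution $$z(x)=\prod_{j=0}^{\infty}\frac{y(q^{n-1+j}\varphi_{s,t}^{n-2}x)}{y(q^{j}\varphi_{s,t}^{n-2}x)} .$$ (1) Under this substitution the deformed $(s,t)$-Bernoulli equation $$D_{\varphi^{n-1},\varphi'^{(n-1)}}y(x)+\alpha(x)\frac{(D_q\mathrm{E}_{s,t})(a,b;x,u)\,\square\,A(x)}{\mathrm{E}_{s,t}[a,b;A(\varphi_{s,t}x),u]}\,y(\varphi_{s,t}^{n-1}x)=\beta(x)\prod_{j=0}^{\infty}\frac{y(q^{j}\varphi_{s,t}^{n-1}x)}{y(q^{n+j}\varphi_{s,t}^{n-1}x)}$$ is converted into the equivalent $(s,t)$-difference equation $$-\frac{1}{\{n-1\}_{s,t}}\mathbf{D}_{s,t}z(x)+\alpha(x)\frac{(D_q\mathrm{E}_{s,t})(a,b;x,u)\,\square\,A(x)}{\mathrm{E}_{s,t}[a,b;A(\varphi_{s,t}x),u]}\,z(\varphi_{s,t}'x)=\beta(x).$$ (2) In a similar way, the equation $$D_{\varphi^{n-1},\varphi'^{(n-1)}}y(x)+\alpha(x)\frac{(D_q\mathrm{E}_{s,t})(a,b;x,u)\,\square\,A(x)}{\mathrm{E}_{s,t}[a,b;A(\varphi_{s,t}'x),u]}\,y(\varphi_{s,t}'^{(n-1)}x)=\beta(x)\prod_{j=0}^{\infty}\frac{y(q^{j}\varphi_{s,t}^{n-1}x)}{y(q^{n+j}\varphi_{s,t}^{n-1}x)}$$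 is converted to the $(s,t)$-difference equation $$-\frac{1}{\{n-1\}_{s,t}}\mathbf{D}_{s,t}z(x)+\alpha(x)\frac{(D_q\mathrm{E}_{s,t})(a,b;x,u)\,\square\,A(x)}{\mathrm{E}_{s,t}[a,b;A(\varphi_{s,t}'x),u]}\,z(\varphi_{s,t}x)=\beta(x).$$
   Context: Let $s,t\in\mathbb{R}$, $s\ne0$, $t\ne0$, $\varphi_{s,t}=\frac{s+\sqrt{s^2+4t}}{2}$, $\varphi_{s,t}'=\frac{s-\sqrt{s^2+4t}}{2}$, $q=\varphi_{s,t}'/\varphi_{s,t}$. Put $\{m\}_{s,t}=\frac{\varphi_{s,t}^{m}-\varphi_{s,t}'^{\,m}}{\varphi_{s,t}-\varphi_{s,t}'}$ (for nonnegative integers $m$ these are the generalized Fibonacci polynomials, $\{0\}_{s,t}=0$, $\{1\}_{s,t}=1$, $\{m+2\}_{s,t}=s\{m+1\}_{s,t}+t\{m\}_{s,t}$), and $\{m\}_{s,t}!=\{1\}_{s,t}\cdots\{m\}_{s,t}$. For $x\neq0$, $$\mathbf{D}_{s,t}f(x)=\frac{f(\varphi_{s,t}x)-f(\varphi_{s,t}'x)}{(\varphi_{s,t}-\varphi_{s,t}')x},\qquad D_qf(x)=\frac{f(x)-f(qx)}{(1-q)x},$$ $$D_{\varphi^{n-1},\varphi'^{(n-1)}}f(x)=\frac{f(\varphi_{s,t}^{n-1}x)-f(\varphi_{s,t}'^{(n-1)}x)}{(\varphi_{s,t}^{n-1}-\varphi_{s,t}'^{(n-1)})x},$$ where $\varphi_{s,t}'^{(n-1)}$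 means $\varphi_{s,t}'$ to the power $n-1$. The pantograph function is $\mathrm{E}_{s,t}(a,b;z,u)=\sum_{m\ge0}(a\oplus b)_{1,u}^m\frac{z^m}{\{m\}_{s,t}!}$ with $(a\oplus b)_{1,u}^0=1$ and $(a\oplus b)_{1,u}^m=\prod_{k=0}^{m-1}(a+bu^k)$ for $m\ge1$. $A(x)=\int_\eta^x\alpha(r)\,d_qr$, where $\int_c^d f(x)\,d_qx=(1-q)\sum_{m\ge0}[d f(dq^m)-c f(cq^m)]q^m$. For a function of the form $f(x)=\sum_{m\ge1}f_m\frac{x^m}{\{m\}_{s,t}!}$, symbolic powers are defined by $f^{[0]}=1$ and $\mathbf{D}_{s,t}f^{[k]}(x)=\{k\}_{s,t}f^{[k-1]}(x)\mathbf{D}_{s,t}f(x)$ with $f^{[k]}(0)=0$ for $k\ge1$. The composition $g\,\square\,f(x)$ replaces each power $x^m$ in the series $g(x)$ by $f^{[m]}(x)$; in particular $\mathrm{E}_{s,t}[a,b;f(x),u]=\mathrm{E}_{s,t}(a,b;x,u)\,\square\,f(x)=\sum_{m\ge0}(a\oplus b)_{1,u}^m\frac{f^{[m]}(x)}{\{m\}_{s,t}!}$. This notation is applied with $f=A$, and $\mathrm{E}_{s,t}[a,b;A(\lambda x),u]$ is the value of $x\mapsto\mathrm{E}_{s,t}[a,b;A(x),u]$ at $\lambda x$.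
   Formalization: Added assumption: the infinite products converge (nonzero limit, nonvanishing denominators) and y(q^j φ^{n-1} x) → 1 as j → ∞; without the last condition the equivalence fails, e.g. for constant y = 2, where z = 1. *)

(* Defs.v *)
From Stdlib Require Import Reals Lra Lia.
From Coquelicot Require Import Coquelicot.
Open Scope C_scope.

(* Total limit, series and product operators: the value is the usual one
   whenever the limit exists. *)
Definition Clim_seq (w : nat -> C) : C :=
  (real (Lim_seq (fun m => Re (w m))), real (Lim_seq (fun m => Im (w m)))).

Definition CSeries (w : nat -> C) : C :=
  (Series (fun m => Re (w m)), Series (fun m => Im (w m))).

(* f 0 * ... * f (m - 1) *)
Fixpoint Cprod (f : nat -> C) (m : nat) : C :=
  match m with
  | O => 1
  | S k => Cprod f k * f k
  end.

Definition Cprod_inf (f : nat -> C) : C := Clim_seq (Cprod f).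

Definition Cseq_to (w : nat -> C) (l : C) : Prop :=
  filterlim w eventually (locally l).

(* Principal argument, in (-PI, PI]. *)
Definition Carg (z : C) : R :=
  if Rle_dec 0 (Im z) then acos (Re z / Cmod z) else (- acos (Re z / Cmod z))%R.

(* Principal value of z ^ r for z <> 0 and r real. *)
Definition cpow (z : C) (r : R) : C :=
  RtoC (Rpower (Cmod z) r) * (cos (r * Carg z), sin (r * Carg z)).

(* Stdlib's sqrt vanishes on negative reals, so (sqrt D, sqrt (- D)) is
   sqrt D for D >= 0 and i * sqrt (- D) for D < 0. *)
Definition disc_sqrt (s t : R) : C :=
  (sqrt (s ^ 2 + 4 * t), sqrt (- (s ^ 2 + 4 * t))).

Definition phi (s t : R) : C := (RtoC s + disc_sqrt s t) / 2.
Definition phi' (s t : R) : C := (RtoC s - disc_sqrt s t) / 2.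
Definition qst (s t : R) : C := phi' s t / phi s t.

(* q ^ r as phi' ^ r / phi ^ r, the branch for which q ^ r * phi ^ r = phi' ^ r.
   It is the principal power of q when phi and phi' are real (phi < 0 forces
   phi' < 0, because phi' <= phi) or r is an integer. *)
Definition qpow (s t r : R) : C := cpow (phi' s t) r / cpow (phi s t) r.

Definition fibnum (s t r : R) : C :=
  (cpow (phi s t) r - cpow (phi' s t) r) / (phi s t - phi' s t).

Definition fibfact (s t : R) (m : nat) : C :=
  Cprod (fun k => fibnum s t (INR (S k))) m.

Definition Dst (s t : R) (f : C -> C) (x : C) : C :=
  (f (phi s t * x) - f (phi' s t * x)) / ((phi s t - phi' s t) * x).

Definition Dq (q : C) (f : C -> C) (x : C) : C :=
  (f x - f (q * x)) / ((1 - q) * x).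

Definition Dpow (s t r : R) (f : C -> C) (x : C) : C :=
  (f (cpow (phi s t) r * x) - f (cpow (phi' s t) r * x))
  / ((cpow (phi s t) r - cpow (phi' s t) r) * x).

Definition Jackson (q : C) (f : C -> C) (c d : C) : C :=
  (1 - q) * CSeries (fun m => (d * f (d * q ^ m) - c * f (c * q ^ m)) * q ^ m).

(* (a (+) b)_{1,u}^m *)
Definition oplus_pow (a b u : C) (m : nat) : C :=
  Cprod (fun k => a + b * u ^ k) m.

(* Coefficients of E_{s,t}(a,b;z,u) as a power series in z. *)
Definition panto_coef (s t : R) (a b u : C) (m : nat) : C :=
  oplus_pow a b u m / fibfact s t m.

(* Coefficients of D_q g for g(x) = sum g_m x^m: D_q acts termwise by
   D_q x^(m+1) = (1 - q^(m+1)) / (1 - q) * x^m (see Dq_pseries below). *)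
Definition Dq_coef (q : C) (g : nat -> C) (m : nat) : C :=
  (1 - q ^ S m) / (1 - q) * g (S m).

(* P k plays the role of the symbolic power f^[k].  The equations are required
   at the points of I, the domain of the functions considered; continuity at 0
   is what makes the initial condition f^[k](0) = 0 determine f^[k] (D_{s,t}
   kills every function satisfying g (phi x) = g (phi' x) away from 0). *)
Definition symbolic_powers (s t : R) (I : C -> Prop) (f : C -> C)
    (P : nat -> C -> C) : Prop :=
  (forall x, P O x = 1) /\
  (forall k, P (S k) 0 = 0) /\
  (forall k, filterlim (P (S k)) (within I (locally (RtoC 0))) (locally (RtoC 0))) /\
  (forall (k : nat) (x : C), I x -> x <> 0 ->
     Dst s t (P (S k)) x = fibnum s t (INR (S k)) * P k x * Dst s t f x).

(* g [] f (x) = sum g_m f^[m](x), with P m = f^[m]. *)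
Definition square_comp (g : nat -> C) (P : nat -> C -> C) (x : C) : C :=
  CSeries (fun m => g m * P m x).

Definition subst_factor (s t n : R) (y : C -> C) (x : C) (j : nat) : C :=
  y (qpow s t (n - 1 + INR j) * cpow (phi s t) (n - 2) * x)
  / y (qpow s t (INR j) * cpow (phi s t) (n - 2) * x).

Definition subst (s t n : R) (y : C -> C) (x : C) : C :=
  Cprod_inf (subst_factor s t n y x).

(* The factor multiplying beta(x) on the right-hand side. *)
Definition rhs_prod (s t n : R) (y : C -> C) (x : C) : C :=
  Cprod_inf (fun j =>
    y (qpow s t (INR j) * cpow (phi s t) (n - 1) * x)
    / y (qpow s t (n + INR j) * cpow (phi s t) (n - 1) * x)).

(* The infinite products met at the point x are meaningful: no denominator
   vanishes, the product z(phi' x) converges (to a nonzero limit), and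
   y(q^j phi^(n-1) x) -> 1, the necessary condition for the convergence of
   prod_j y(q^j phi^(n-1) x).  The convergence of z(phi x) and of the product
   on the right-hand side follows.  The limit has to be 1: for y constant
   equal to c one has z = 1, while c remains as a factor in the equation
   for y. *)
Definition admissible (s t n : R) (y : C -> C) (x : C) : Prop :=
  (forall j, y (qpow s t (INR j) * cpow (phi s t) (n - 1) * x) <> 0) /\
  (forall j, y (qpow s t (n + INR j) * cpow (phi s t) (n - 1) * x) <> 0) /\
  (exists l : C, l <> 0 /\ Cseq_to (Cprod (subst_factor s t n y (phi' s t * x))) l) /\
  Cseq_to (fun j => y (qpow s t (INR j) * cpow (phi s t) (n - 1) * x)) 1.

Lemma disc_sqrt_sqr (s t : R) : disc_sqrt s t * disc_sqrt s t = RtoC (s ^ 2 + 4 * t).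
Proof.
unfold disc_sqrt; generalize (s ^ 2 + 4 * t)%R; intros D.
unfold Cmult, RtoC; cbn [fst snd].
destruct (Rle_dec 0 D) as [H|H].
- rewrite (sqrt_neg_0 (- D)) by lra.
  rewrite (sqrt_sqrt D H); f_equal; ring.
- rewrite (sqrt_neg_0 D) by lra.
  rewrite (sqrt_sqrt (- D)) by lra; f_equal; ring.
Qed.

Lemma phi_add (s t : R) : phi s t + phi' s t = RtoC s.
Proof. unfold phi, phi'; field. Qed.

Lemma phi_mul (s t : R) : phi s t * phi' s t = RtoC (- t).
Proof.
unfold phi, phi'.
replace ((RtoC s + disc_sqrt s t) / 2 * ((RtoC s - disc_sqrt s t) / 2))
  with ((RtoC s * RtoC s - disc_sqrt s t * disc_sqrt s t) / 4) by (field; intro H; apply RtoC_inj in H; lra).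
rewrite disc_sqrt_sqr, <- RtoC_mult, <- RtoC_minus, <- RtoC_div by lra.
f_equal; field.
Qed.

Lemma Carg_cos_sin (z : C) : z <> 0 ->
  z = RtoC (Cmod z) * (cos (Carg z), sin (Carg z)).
Proof.
intros Hz.
assert (Hm : (0 < Cmod z)%R) by (apply Cmod_gt_0; exact Hz).
assert (E : (Cmod z * Cmod z = Re z * Re z + Im z * Im z)%R).
{ unfold Cmod, Re, Im. rewrite sqrt_sqrt; [ring | nra]. }
assert (Hb : (-1 <= Re z / Cmod z <= 1)%R).
{ split.
  - apply Rmult_le_reg_r with (Cmod z); [exact Hm|].
    unfold Rdiv; rewrite Rmult_assoc, Rinv_l by lra. nra.
  - apply Rmult_le_reg_r with (Cmod z); [exact Hm|].
    unfold Rdiv; rewrite Rmult_assoc, Rinv_l by lra. nra. }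
assert (S : (Cmod z * sqrt (1 - Rsqr (Re z / Cmod z)) = Rabs (Im z))%R).
{ rewrite <- (sqrt_Rsqr_abs (Im z)).
  rewrite <- (sqrt_Rsqr (Cmod z)) at 1 by lra.
  rewrite <- sqrt_mult.
  - f_equal. unfold Rsqr. transitivity (Cmod z * Cmod z - Re z * Re z)%R; [field; lra|lra].
  - apply Rle_0_sqr.
  - unfold Rsqr; nra. }
assert (Cs : cos (Carg z) = (Re z / Cmod z)%R).
{ unfold Carg; destruct (Rle_dec 0 (Im z)); [|rewrite cos_neg]; apply cos_acos; exact Hb. }
assert (Sn : (Cmod z * sin (Carg z) = Im z)%R).
{ unfold Carg; destruct (Rle_dec 0 (Im z)) as [h|h].
  - rewrite sin_acos by exact Hb. rewrite S. apply Rabs_pos_eq, h.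
  - rewrite sin_neg, sin_acos by exact Hb.
    rewrite Ropp_mult_distr_r_reverse, S, Rabs_left by lra. ring. }
unfold Cmult, RtoC; simpl fst; simpl snd.
rewrite Rmult_0_l, Rmult_0_l, Sn, Cs.
destruct z as [zr zi]; unfold Re, Im in *; simpl fst in *; simpl snd in *.
f_equal; field; lra.
Qed.

Lemma cpow_add (z : C) (r r' : R) : cpow z (r + r') = cpow z r * cpow z r'.
Proof.
unfold cpow. rewrite Rpower_plus, !Rmult_plus_distr_r, cos_plus, sin_plus.
unfold Cmult, RtoC; simpl; f_equal; ring.
Qed.

Lemma cpow_1 (z : C) : z <> 0 -> cpow z 1 = z.
Proof.
intros Hz. unfold cpow. rewrite Rmult_1_l, Rpower_1.
- symmetry; apply Carg_cos_sin, Hz.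
- apply Cmod_gt_0, Hz.
Qed.

Lemma cpow_INR (z : C) (m : nat) : z <> 0 -> cpow z (INR m) = z ^ m.
Proof.
intros Hz; induction m as [|m IH].
- simpl. unfold cpow. rewrite Rmult_0_l, cos_0, sin_0.
  unfold Rpower; rewrite Rmult_0_l, exp_0.
  unfold Cmult, RtoC; simpl; f_equal; ring.
- rewrite S_INR, cpow_add, IH, cpow_1, Cpow_S by exact Hz. apply Cmult_comm.
Qed.

Lemma cpow_pos (x r : R) : (0 < x)%R -> cpow (RtoC x) r = RtoC (Rpower x r).
Proof.
intros Hx. unfold cpow, Carg. simpl (Im _). simpl (Re _).
rewrite Cmod_R, Rabs_pos_eq by lra.
destruct (Rle_dec 0 0) as [_|h]; [|lra].
replace (x / x)%R with 1%R by (field; lra).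
rewrite acos_1, Rmult_0_r, cos_0, sin_0.
unfold Cmult, RtoC; simpl; f_equal; ring.
Qed.

Lemma phi_neq_0 (s t : R) : t <> 0%R -> phi s t <> 0.
Proof.
intros Ht H. generalize (phi_mul s t). rewrite H, Cmult_0_l.
intros E; apply RtoC_inj in E; lra.
Qed.

Lemma phi'_neq_0 (s t : R) : t <> 0%R -> phi' s t <> 0.
Proof.
intros Ht H. generalize (phi_mul s t). rewrite H, Cmult_0_r.
intros E; apply RtoC_inj in E; lra.
Qed.

Lemma fibnum_rec (s t : R) (m : nat) : t <> 0%R ->
  fibnum s t (INR (S (S m))) =
  RtoC s * fibnum s t (INR (S m)) + RtoC t * fibnum s t (INR m).
Proof.
intros Ht. unfold fibnum.
rewrite !cpow_INR by (apply phi_neq_0 || apply phi'_neq_0; exact Ht).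
rewrite <- (phi_add s t).
replace (RtoC t) with (- (phi s t * phi' s t)) by (rewrite phi_mul, <- RtoC_opp; f_equal; ring).
rewrite !Cpow_S. unfold Cdiv. ring.
Qed.

Lemma Dq_pseries (q : C) (g : nat -> C) (G : C -> C) (x : C) :
  q <> 1 -> x <> 0 ->
  is_series (V := C_NormedModule) (fun m => g m * x ^ m) (G x) ->
  is_series (V := C_NormedModule) (fun m => g m * (q * x) ^ m) (G (q * x)) ->
  is_series (V := C_NormedModule) (fun m => Dq_coef q g m * x ^ m) (Dq q G x).
Proof.
intros Hq Hx H1 H2.
assert (Hq' : 1 - q <> 0) by (intro E; apply Hq; replace q with (1 - (1 - q)) by ring; rewrite E; ring).
generalize (is_series_minus _ _ _ _ H1 H2); intros H3.
apply (is_series_scal (/ ((1 - q) * x))) in H3.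
refine (is_series_ext _ _ _ _ (is_series_incr_1 (V := C_NormedModule)
  (fun m => / ((1 - q) * x) * (g m * x ^ m - g m * (q * x) ^ m)) _ _)).
- intros m; unfold Dq_coef; cbv beta.
  match goal with |- @eq _ ?l ?r => change (@eq C l r) end.
  rewrite !Cpow_mult_l, !Cpow_S.
  field; split; assumption.
- match type of H3 with is_series _ ?l => replace (plus _ _) with l; [exact H3|] end.
  change (@eq C (/ ((1 - q) * x) * (G x - G (q * x)))
          (Dq q G x + / ((1 - q) * x) * (g O * x ^ 0 - g O * (q * x) ^ 0))).
  unfold Dq; simpl; field; split; assumption.
Qed.

(* Main.v *)
Require Import Defs.
From Stdlib Require Import Reals Lra.
From Coquelicot Require Import Coquelicot.
Open Scope C_scope.

(** Write [w r = y (q^r phi^(n-1) x)].  Since [phi' = q phi], the product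
    [z (phi' x)] has factors [w (n + j) / w (1 + j)], while [z (phi x)] has
    factors [w (n - 1 + j) / w j] and the product on the right-hand side has
    factors [w j / w (n + j)].  If [l] is the value of the first product, the
    second is the first with one more factor in front, [w (n - 1) / w 0 * l],
    and the third telescopes against the first to [w 0 / l].  Multiplying the
    equation for [y] by [l / w 0] then gives the equation for [z]. *)

(** * Limits of complex sequences, by reduction to real ones *)

Lemma Cseq_to_Re_Im (w : nat -> C) (l : C) :
  Cseq_to w l <->
  is_lim_seq (fun m => Re (w m)) (Re l) /\ is_lim_seq (fun m => Im (w m)) (Im l).
Proof.
split.
(* Balls in [C] are products of real balls, so one [eps] serves both coordinates. *)
- intros H; split; apply is_lim_seq_spec; intros eps;
    destruct (proj1 (filterlim_locally w l) H eps) as [N HN];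
    exists N; intros m Hm; destruct (HN m Hm) as [H1 H2].
  + exact H1.
  + exact H2.
- intros [H1 H2]. apply filterlim_locally; intros eps.
  apply is_lim_seq_spec in H1; apply is_lim_seq_spec in H2.
  destruct (H1 eps) as [N1 HN1]; destruct (H2 eps) as [N2 HN2].
  exists (Nat.max N1 N2); intros m Hm; split.
  + apply HN1, (Nat.le_trans _ _ _ (Nat.le_max_l N1 N2) Hm).
  + apply HN2, (Nat.le_trans _ _ _ (Nat.le_max_r N1 N2) Hm).
Qed.

Lemma Clim_seq_unique (w : nat -> C) (l : C) : Cseq_to w l -> Clim_seq w = l.
Proof.
intros H; apply Cseq_to_Re_Im in H; destruct H as [H1 H2].
unfold Clim_seq; rewrite (is_lim_seq_unique _ _ H1), (is_lim_seq_unique _ _ H2).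
destruct l; reflexivity.
Qed.

Lemma Cseq_to_ext (v w : nat -> C) (l : C) :
  (forall m, v m = w m) -> Cseq_to v l -> Cseq_to w l.
Proof. exact (fun E => filterlim_ext v w E). Qed.

Lemma Cseq_to_const (c : C) : Cseq_to (fun _ => c) c.
Proof. apply filterlim_const. Qed.

Lemma Cseq_to_incr_1 (w : nat -> C) (l : C) :
  Cseq_to (fun m => w (S m)) l -> Cseq_to w l.
Proof.
intros H; apply Cseq_to_Re_Im in H; destruct H as [H1 H2]; apply Cseq_to_Re_Im.
split; apply is_lim_seq_incr_1; assumption.
Qed.

Lemma Cseq_to_mult (v w : nat -> C) (k l : C) :
  Cseq_to v k -> Cseq_to w l -> Cseq_to (fun m => v m * w m) (k * l).
Proof.
intros Hv Hw; apply Cseq_to_Re_Im in Hv; apply Cseq_to_Re_Im in Hw.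
destruct Hv as [Hv1 Hv2]; destruct Hw as [Hw1 Hw2]; apply Cseq_to_Re_Im; split.
- apply is_lim_seq_minus'; apply is_lim_seq_mult'; assumption.
- apply is_lim_seq_plus'; apply is_lim_seq_mult'; assumption.
Qed.

Lemma Cseq_to_inv (w : nat -> C) (l : C) :
  l <> 0 -> Cseq_to w l -> Cseq_to (fun m => / w m) (/ l).
Proof.
intros Hl Hw; apply Cseq_to_Re_Im in Hw; destruct Hw as [H1 H2].
(* The components of [/ w m] are real quotients with this common denominator, the squared
   modulus. *)
assert (Hn : is_lim_seq (fun m => (Re (w m) ^ 2 + Im (w m) ^ 2)%R)
                        (Re l ^ 2 + Im l ^ 2)%R).
{ apply is_lim_seq_plus'; simpl;
    repeat apply is_lim_seq_mult'; try assumption; apply is_lim_seq_const. }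
assert (Hl' : (Re l ^ 2 + Im l ^ 2)%R <> 0%R).
{ intros E; apply Hl; destruct l as [p r]; unfold Re, Im in E; cbn [fst snd] in E.
  assert (p = 0%R) by nra; assert (r = 0%R) by nra; subst; reflexivity. }
apply Cseq_to_Re_Im; split.
- apply (is_lim_seq_div' _ _ _ _ H1 Hn Hl').
- apply (fun H => is_lim_seq_div' _ _ _ _ H Hn Hl').
  apply (proj1 (is_lim_seq_opp _ _) H2).
Qed.

(** * Finite products *)

Lemma Cprod_ext (f g : nat -> C) (m : nat) :
  (forall j, f j = g j) -> Cprod f m = Cprod g m.
Proof. intros E; induction m as [|m IH]; simpl; [|rewrite IH, E]; reflexivity. Qed.

Lemma Cprod_S_l (f : nat -> C) (m : nat) :
  Cprod f (S m) = f O * Cprod (fun j => f (S j)) m.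
Proof.
induction m as [|m IH].
- simpl; ring.
- change (Cprod f (S m) * f (S m) = f O * (Cprod (fun j => f (S j)) m * f (S m))).
  rewrite IH; ring.
Qed.

Lemma Cprod_neq_0 (f : nat -> C) (m : nat) :
  (forall j, f j <> 0) -> Cprod f m <> 0.
Proof.
intros H; induction m as [|m IH]; simpl.
- exact C1_nz.
- apply Cmult_neq_0; [exact IH | apply H].
Qed.

Lemma Cinv_neq_0 (c : C) : c <> 0 -> / c <> 0.
Proof.
intros Hc H; apply C1_nz; rewrite <- (Cinv_r c Hc), H; apply Cmult_0_r.
Qed.

Lemma Cdiv_neq_0 (c d : C) : c <> 0 -> d <> 0 -> c / d <> 0.
Proof. intros Hc Hd; apply Cmult_neq_0; [exact Hc | apply Cinv_neq_0, Hd]. Qed.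

(** Multiplying the two products factor by factor leaves [w j / w (S j)], which telescopes to
    [w O / w m]. *)
Lemma Cprod_div_telescope (v w : nat -> C) (m : nat) :
  (forall j, v j <> 0) -> (forall j, w j <> 0) ->
  Cprod (fun j => w j / v j) m
  = w O / w m * / Cprod (fun j => v j / w (S j)) m.
Proof.
intros Hv Hw; induction m as [|m IH]; simpl.
- field; apply Hw.
- rewrite IH.
  assert (H : Cprod (fun j => v j / w (S j)) m <> 0)
    by (apply Cprod_neq_0; intros j; apply Cdiv_neq_0; auto).
  field; repeat split; auto.
Qed.

(** * Inverse of zero and powers of the two roots *)

Lemma Cinv_0 : / RtoC 0 = 0.
Proof. unfold Cinv, RtoC; simpl; f_equal; unfold Rdiv; ring. Qed.

Lemma cpow_neq_0 (c : C) (r : R) : cpow c r <> 0.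
Proof.
intros H.
(* [Rpower] is an exponential, so the exponents [r] and [- r] cancel even when [c] is zero. *)
assert (E : cpow c (r + - r) = 1).
{ rewrite Rplus_opp_r; unfold cpow, Rpower.
  rewrite !Rmult_0_l, exp_0, cos_0, sin_0; apply Cmult_1_l. }
rewrite cpow_add, H, Cmult_0_l in E; exact (C1_nz (eq_sym E)).
Qed.

Lemma qpow_0 (s t : R) : qpow s t 0 = 1.
Proof.
unfold qpow, cpow, Rpower.
rewrite !Rmult_0_l, exp_0, cos_0, sin_0.
change (RtoC 1 * RtoC 1 / (RtoC 1 * RtoC 1) = RtoC 1); field; exact C1_nz.
Qed.

Lemma qpow_mul_cpow_phi (s t r : R) :
  qpow s t r * cpow (phi s t) r = cpow (phi' s t) r.
Proof. unfold qpow; field; apply cpow_neq_0. Qed.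

(** This is [q * phi = phi'] in terms of exponents: trading [phi] for [phi'] costs one power of
    [q]. *)
Lemma qpow_succ_mul_phi (s t r : R) : t <> 0%R ->
  qpow s t (1 + r) * phi s t = qpow s t r * phi' s t.
Proof.
intros Ht; unfold qpow; rewrite !cpow_add.
rewrite (cpow_1 _ (phi_neq_0 s t Ht)), (cpow_1 _ (phi'_neq_0 s t Ht)).
field; split; [apply cpow_neq_0 | apply phi_neq_0, Ht].
Qed.

Lemma cpow_phi_pred (s t n : R) : t <> 0%R ->
  cpow (phi s t) (n - 1) = cpow (phi s t) (n - 2) * phi s t.
Proof.
intros Ht; rewrite <- (cpow_1 _ (phi_neq_0 s t Ht)) at 3.
rewrite <- cpow_add; f_equal; ring.
Qed.

Lemma phi_sub_neq_0 (s t : R) :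
  (s ^ 2 + 4 * t)%R <> 0%R -> phi s t - phi' s t <> 0.
Proof.
intros Hst H.
assert (E : phi s t - phi' s t = disc_sqrt s t) by (unfold phi, phi'; field).
rewrite E in H; generalize (disc_sqrt_sqr s t); rewrite H, Cmult_0_l.
intros E'; apply RtoC_inj in E'; lra.
Qed.

(** * The infinite products and the passage between the equations *)

Lemma subst_factor_phi (s t n : R) (y : C -> C) (x : C) (j : nat) : t <> 0%R ->
  subst_factor s t n y (phi s t * x) j
  = y (qpow s t (n - 1 + INR j) * cpow (phi s t) (n - 1) * x)
    / y (qpow s t (INR j) * cpow (phi s t) (n - 1) * x).
Proof.
intros Ht; unfold subst_factor; rewrite (cpow_phi_pred s t n Ht), !Cmult_assoc.
reflexivity.
Qed.

(** Evaluating at [phi' x = q phi x] raises every exponent of [q] by one, so the denominators start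
    at index 1 and the numerators at [n]. *)
Lemma subst_factor_phi' (s t n : R) (y : C -> C) (x : C) (j : nat) : t <> 0%R ->
  subst_factor s t n y (phi' s t * x) j
  = y (qpow s t (n + INR j) * cpow (phi s t) (n - 1) * x)
    / y (qpow s t (INR (S j)) * cpow (phi s t) (n - 1) * x).
Proof.
intros Ht; unfold subst_factor; rewrite (cpow_phi_pred s t n Ht).
assert (H : forall r, qpow s t r * cpow (phi s t) (n - 2) * (phi' s t * x)
                    = qpow s t (1 + r) * (cpow (phi s t) (n - 2) * phi s t) * x).
{ intros r; transitivity (qpow s t r * phi' s t * (cpow (phi s t) (n - 2) * x)).
  - ring.
  - rewrite <- qpow_succ_mul_phi by exact Ht; ring. }
rewrite !H, S_INR.
replace (1 + (n - 1 + INR j))%R with (n + INR j)%R by ring.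
rewrite (Rplus_comm (INR j)); reflexivity.
Qed.

Lemma admissible_products (s t n : R) (y : C -> C) (x : C) :
  t <> 0%R -> admissible s t n y x ->
  y (cpow (phi s t) (n - 1) * x) <> 0 /\
  exists l : C, l <> 0 /\
    subst s t n y (phi' s t * x) = l /\
    subst s t n y (phi s t * x)
    = y (cpow (phi' s t) (n - 1) * x) / y (cpow (phi s t) (n - 1) * x) * l /\
    rhs_prod s t n y x = y (cpow (phi s t) (n - 1) * x) / l.
Proof.
intros Ht [Hw [Hv [[l [Hl Hlim]] H1]]].
set (w := fun j : nat => y (qpow s t (INR j) * cpow (phi s t) (n - 1) * x)).
set (v := fun j : nat => y (qpow s t (n + INR j) * cpow (phi s t) (n - 1) * x)).
assert (W0 : w O = y (cpow (phi s t) (n - 1) * x))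
  by (unfold w; simpl INR; rewrite qpow_0, Cmult_1_l; reflexivity).
assert (HQ : Cseq_to (Cprod (fun j => v j / w (S j))) l).
{ refine (Cseq_to_ext _ _ _ _ Hlim); intros m; apply Cprod_ext; intros j.
  apply subst_factor_phi', Ht. }
rewrite <- W0; split; [apply Hw|].
exists l; split; [exact Hl|]; split; [|split].
- apply Clim_seq_unique, Hlim.
(* Shifting the partial products by one lets the factor of index 0 be split off in front of the
   product for [phi' x]. *)
- apply Clim_seq_unique, Cseq_to_incr_1.
  refine (Cseq_to_ext _ _ _ _ (Cseq_to_mult _ _ _ _ (Cseq_to_const _) HQ)).
  intros m; rewrite Cprod_S_l; f_equal.
  (* At index 0 the numerator is taken at [q^(n-1) phi^(n-1) x], that is, at [phi'^(n-1) x]. *)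
  + rewrite subst_factor_phi by exact Ht; simpl INR.
    rewrite Rplus_0_r, qpow_mul_cpow_phi; reflexivity.
  + apply Cprod_ext; intros j; rewrite subst_factor_phi by exact Ht.
    unfold v, w; do 4 f_equal; rewrite S_INR; f_equal; ring.
- apply Clim_seq_unique.
  (* The inserted [/ 1] is the limit of [/ w m] in the telescoped partial products. *)
  replace (w O / l) with (w O * / 1 * / l) by (field; exact Hl).
  apply Cseq_to_ext with (fun m => w O * / w m * / Cprod (fun j => v j / w (S j)) m).
  + intros m; symmetry; exact (Cprod_div_telescope v w m Hv Hw).
  + apply Cseq_to_mult; [|apply Cseq_to_inv; [exact Hl | exact HQ]].
    apply Cseq_to_mult; [apply Cseq_to_const|].
    apply Cseq_to_inv; [exact C1_nz | exact H1].
Qed.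

(** The factor [phi - phi'] cancels between [fibnum] and [Dst], leaving the denominator of [Dpow].
    The minus sign restores the order of the two values of [y], since the one at [phi'^(n-1) x]
    comes from [z (phi x)]. *)
Lemma Dst_subst (s t n : R) (y : C -> C) (x l : C) :
  (s ^ 2 + 4 * t)%R <> 0%R -> x <> 0 ->
  y (cpow (phi s t) (n - 1) * x) <> 0 ->
  subst s t n y (phi' s t * x) = l ->
  subst s t n y (phi s t * x)
  = y (cpow (phi' s t) (n - 1) * x) / y (cpow (phi s t) (n - 1) * x) * l ->
  - (1 / fibnum s t (n - 1)) * Dst s t (subst s t n y) x
  = l / y (cpow (phi s t) (n - 1) * x) * Dpow s t (n - 1) y x.
Proof.
intros Hst Hx H0 E' E; unfold Dst, Dpow, fibnum; rewrite E', E.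
assert (Hd := phi_sub_neq_0 s t Hst).
set (D := cpow (phi s t) (n - 1) - cpow (phi' s t) (n - 1)).
(* [D] vanishes for some nonreal [phi]; both sides are then [0], because [/ 0 = 0]. *)
destruct (Ceq_dec D 0) as [HD|HD].
- rewrite HD; unfold Cdiv; rewrite !Cmult_0_l, Cinv_0; ring.
- field; repeat split; assumption.
Qed.

Lemma Ceq_scal_iff (c p r : C) : c <> 0 -> (p = r <-> c * p = c * r).
Proof.
intros Hc; split; intros H.
- rewrite H; reflexivity.
- transitivity (/ c * (c * p)); [field; exact Hc|].
  rewrite H; field; exact Hc.
Qed.

(* I is the domain on which the equations are considered (for instance the
   real line, or C). *)
Theorem mainTheorem4 (s t n : R) (a b u eta : C)
    (I : C -> Prop) (alpha beta y : C -> C) (Apow : nat -> C -> C)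
    (hs : s <> 0%R) (ht : t <> 0%R) (hst : (s ^ 2 + 4 * t)%R <> 0%R)
    (hn0 : n <> 0%R) (hn1 : n <> 1%R)
    (halpha : continuous_on I alpha) (hbeta : continuous_on I beta)
    (hApow : symbolic_powers s t I (Jackson (qst s t) alpha eta) Apow)
    (hy : forall x : C, I x -> x <> 0 -> admissible s t n y x) :
  let E := panto_coef s t a b u in
  let DqE := Dq_coef (qst s t) E in
  let z := subst s t n y in
  (forall x : C, I x -> x <> 0 ->
    (Dpow s t (n - 1) y x
     + alpha x * (square_comp DqE Apow x / square_comp E Apow (phi s t * x))
       * y (cpow (phi s t) (n - 1) * x)
     = beta x * rhs_prod s t n y x
     <->
     - (1 / fibnum s t (n - 1)) * Dst s t z x
     + alpha x * (square_comp DqE Apow x / square_comp E Apow (phi s t * x))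
       * z (phi' s t * x)
     = beta x))
  /\
  (forall x : C, I x -> x <> 0 ->
    (Dpow s t (n - 1) y x
     + alpha x * (square_comp DqE Apow x / square_comp E Apow (phi' s t * x))
       * y (cpow (phi' s t) (n - 1) * x)
     = beta x * rhs_prod s t n y x
     <->
     - (1 / fibnum s t (n - 1)) * Dst s t z x
     + alpha x * (square_comp DqE Apow x / square_comp E Apow (phi' s t * x))
       * z (phi s t * x)
     = beta x)).
Proof.
intros E DqE z.
split; intros x HI Hx;
  destruct (admissible_products s t n y x ht (hy x HI Hx)) as [H0 [l [Hl [E1 [E2 E3]]]]];
  unfold z; rewrite (Dst_subst s t n y x l hst Hx H0 E1 E2), ?E1, ?E2, E3;
  (* The same multiplier serves both halves: it sends [y (phi^(n-1) x)] to [z (phi' x)] and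
     [y (phi'^(n-1) x)] to [z (phi x)]. *)
  refine (iff_trans (Ceq_scal_iff (l / y (cpow (phi s t) (n - 1) * x)) _ _
                       (Cdiv_neq_0 _ _ Hl H0)) _);
  (* As an atom, the pantograph quotient does not make [field] ask for a nonzero denominator. *)
  set (K := square_comp DqE Apow x / _);
  match goal with |- ?p = ?r <-> ?p' = ?r' =>
    replace p with p' by (field; assumption);
    replace r with r' by (field; split; assumption) end;
  reflexivity.
Qed.
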